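(* Let $\alpha\in(0,1)$ be irrational and $\beta\in[0,1)$. Let $\ell\in\mathbb{Z}_{\ge0}\cup\{\infty\}$ and the right-admissible digit string $\langle b_k\rangle_1^\ell$ be the output of the absolute base-$\alpha$ expansion algorithm applied to $\beta$, so that $\beta=\sum_{k=1}^\ell b_k|\theta_{k-1}|$, and let $T_n^\nearrow=\sum_{k=1}^n b_kq_{k-1}^*$ for $1\le n<\ell+1$. Then the sequence $\langle T_n^\nearrow\rangle_1^\ell$ is the solution to the total under $(\alpha,\beta)$-linear approximate problem; that is, it is a sequence of total under $(\alpha,\beta)$-approximates which is a general solution: (i) $|T_n^\nearrow|\le q_n$ for $1\le n<\ell+1$; (ii) $0<\|\beta-T_n^\nearrow\alpha\|<|\theta_{n-1}|$ for $1\le n<\ell$; (iii) $\|\beta-T_\ell^\nearrow\alpha\|=0$, read as $\lim_{n\to\infty}\|\beta-T_n^\nearrow\alpha\|=0$ when $\ell=\infty$.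
   Context: $(r)=r-\lfloor r\rfloor$ is the fractional part of a real $r$, and $\|r\|=\min\{(r),1-(r)\}$ is the distance from $r$ to the nearest integer; $\infty\pm1=\infty$; empty sums are $0$. For irrational $\alpha\in(0,1)$, set $\alpha_0=\alpha$ and, for $k\ge1$, $a_k=\lfloor 1/\alpha_{k-1}\rfloor$, $\alpha_k=1/\alpha_{k-1}-a_k$ (the continued fraction digits of $\alpha$). Let $p_{-1}=1,\ p_0=0,\ p_k=a_kp_{k-1}+p_{k-2}$ and $q_{-1}=0,\ q_0=1,\ q_k=a_kq_{k-1}+q_{k-2}$ for $k\ge1$; $q_k^*=(-1)^kq_k$; $\theta_k=q_k\alpha-p_k$ for $k\ge-1$. The absolute base-$\alpha$ expansion algorithm: $\beta_0=\beta$; for $k=1,2,\dots$, as long as $\beta_{k-1}>0$, put $b_k=\lfloor\beta_{k-1}/|\theta_{k-1}|\rfloor$ and $\beta_k=\beta_{k-1}-b_k|\theta_{k-1}|$. If $\beta_\ell=0$ for a first index $\ell$, the algorithm stops and $\ell$ is the limit; otherwise $\ell=\infty$. A digit string $\langle b_k\rangle_1^\ell$ of integers is right-admissible if (a) $0\le b_k\le a_k$ for all $k$, and $b_\ell\ge1$ (for $\ell=\infty$: $\limsup_k b_k\ge1$); (b) $b_k=a_k\implies b_{k+1}=0$ for all $1\le k<\ell-1$; (c) if $\ell=\infty$, then $b_k\le a_k-1$ for infinitely many odd and infinitely many even indices $k$. An $(\alpha,\beta)$-approximate is an integer $m$, with iterate $(m\alpha)$; ''total'' means that positive, negative and zero integers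 are all allowed. The approximate $m$ is over $\beta$ when $(m\alpha)\in[\beta,\beta+.5)$ modulo $1$, and is otherwise under.
   Formalization: ''Under'' is asserted only for 1 ≤ n < ℓ, and not for n = 1 when 1/2 < β < α: in these excluded cases T_n is over β by definition (T_ℓα ≡ β mod 1; T_1 = 0 ≡ 1 lies in [β, β+.5)). Clauses (i)–(iii) are stated in full. *)

(* Defs.v *)
From HB Require Import structures.
From mathcomp Require Import all_boot all_order all_algebra.
From mathcomp Require Import all_classical all_reals all_analysis.
Set Implicit Arguments.
Unset Strict Implicit.
Unset Printing Implicit Defensive.
Import Order.TTheory GRing.Theory Num.Theory.
Import numFieldNormedType.Exports.
Local Open Scope classical_set_scope.
Local Open Scope ring_scope.

(* Elements of N u {oo} are represented in [option nat], with [None] for oo;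
   hence oo +- 1 = oo is [omap succn None = None], [omap predn None = None]. *)
Definition lt_ext (n : nat) (l : option nat) : bool :=
  if l is Some L then (n < L)%N else true.

Definition succ_ext (l : option nat) : option nat := omap succn l.
(* [predn 0 = 0] stands for 0 - 1 here; [lt_ext n] is false at both. *)
Definition pred_ext (l : option nat) : option nat := omap predn l.

Section Approximation.
Context {R : realType}.
Implicit Types (alpha beta r : R) (k n : nat) (m : int) (l : option nat)
  (b a T : nat -> int).

Definition frac_part r : R := r - (Num.floor r)%:~R.

Definition dist_int r : R := Num.min (frac_part r) (1 - frac_part r).

Fixpoint cf_tail alpha k : R :=
  if k is k'.+1
  then (cf_tail alpha k')^-1 - (Num.floor (cf_tail alpha k')^-1)%:~R
  else alpha.

(* a_k; only meaningful for k >= 1 *)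
Definition cf_digit alpha k : int := Num.floor (cf_tail alpha k.-1)^-1.

(* The recursion x_k = a_k x_(k-1) + x_(k-2) with indices shifted by one:
   [cf_rec a u v k] is x_(k-1), where x_(-1) = u and x_0 = v. *)
Fixpoint cf_rec a (u v : int) k : int :=
  match k with
  | 0 => u
  | k1.+1 => if k1 is k2.+1
             then a k1 * cf_rec a u v k1 + cf_rec a u v k2
             else v
  end.

Definition cf_p alpha k : int := cf_rec (cf_digit alpha) 1 0 k.+1.
Definition cf_q alpha k : int := cf_rec (cf_digit alpha) 0 1 k.+1.

Definition cf_qstar alpha k : int := (-1) ^+ k * cf_q alpha k.

Definition theta alpha k : R :=
  (cf_q alpha k)%:~R * alpha - (cf_p alpha k)%:~R.

(* beta_k, for all k: past the first index where it vanishes it stays 0. *)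
Fixpoint remainder alpha beta k : R :=
  if k is k'.+1
  then let r := remainder alpha beta k' in
       r - (Num.floor (r / `|theta alpha k'|))%:~R * `|theta alpha k'|
  else beta.

Definition expansion_limit alpha beta l : Prop :=
  if l is Some L
  then remainder alpha beta L = 0 /\
       (forall k, (k < L)%N -> remainder alpha beta k <> 0)
  else forall k, remainder alpha beta k <> 0.

(* The digit string <b_k>_1^l is a function on [nat] of which only the values
   at 1 <= k < l + 1 are relevant. *)
Definition expansion_output alpha beta l b : Prop :=
  expansion_limit alpha beta l /\
  (forall k, (1 <= k)%N -> lt_ext k (succ_ext l) ->
     b k = Num.floor (remainder alpha beta k.-1 / `|theta alpha k.-1|)).

Definition right_admissible alpha l b : Prop :=
  [/\ (forall k, (1 <= k)%N -> lt_ext k (succ_ext l) ->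
         0 <= b k <= cf_digit alpha k) /\
      (if l is Some L then (1 <= L)%N -> 1 <= b L
       else (1 <= limn_esup (fun k => ((b k)%:~R : R)%:E))%E),
      forall k, (1 <= k)%N -> lt_ext k (pred_ext l) ->
        b k = cf_digit alpha k -> b k.+1 = 0 &
      l = None ->
      infinite_set [set k | (1 <= k)%N /\ odd k /\
                            b k <= cf_digit alpha k - 1] /\
      infinite_set [set k | (1 <= k)%N /\ ~~ odd k /\
                            b k <= cf_digit alpha k - 1]].

Definition expands_to alpha beta l b : Prop :=
  if l is Some L
  then beta = \sum_(1 <= k < L.+1) (b k)%:~R * `|theta alpha k.-1|
  else (fun n => \sum_(1 <= k < n.+1) (b k)%:~R * `|theta alpha k.-1|)
         @ \oo --> beta.

Definition iterate alpha m : R := frac_part (m%:~R * alpha).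

Definition over_approximate alpha beta m : Prop :=
  exists z : int, beta <= iterate alpha m + z%:~R < beta + 2^-1.

Definition under_approximate alpha beta m : Prop :=
  ~ over_approximate alpha beta m.

Definition general_solution alpha beta l T : Prop :=
  [/\ forall n, (1 <= n)%N -> lt_ext n (succ_ext l) ->
        `|T n| <= cf_q alpha n,
      forall n, (1 <= n)%N -> lt_ext n l ->
        0 < dist_int (beta - (T n)%:~R * alpha) < `|theta alpha n.-1| &
      if l is Some L then dist_int (beta - (T L)%:~R * alpha) = 0
      else (fun n => dist_int (beta - (T n)%:~R * alpha)) @ \oo --> (0 : R)].

(* T_n as a function of n; T_0 is the empty sum. *)
Definition up_sum alpha b n : int :=
  \sum_(1 <= k < n.+1) b k * cf_qstar alpha k.-1.

End Approximation.

(* Main.v *)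
(* Since q_(k-1) alpha = theta_(k-1) + p_(k-1) and theta_(k-1) has sign
   (-1)^(k-1), the number T_n alpha is congruent modulo 1 to
   sum_(k <= n) b_k |theta_(k-1)| = beta - beta_n. Hence
   ||beta - T_n alpha|| = ||beta_n||, and everything follows from
   0 <= beta_n < |theta_(n-1)| together with the recursion
   |theta_(k+1)| = |theta_(k-1)| - a_(k+1) |theta_k| and |theta_k| -> 0. *)
Require Import Defs.
From HB Require Import structures.
From mathcomp Require Import all_boot all_order all_algebra.
From mathcomp Require Import all_classical all_reals all_analysis.
From mathcomp Require Import ring lra zify.
Import Order.TTheory GRing.Theory Num.Theory.
Import numFieldNormedType.Exports.
Local Open Scope classical_set_scope.
Local Open Scope ring_scope.

(** * Continued fraction of [alpha]: recursions, signs and decay of the theta_k *)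

Section ContinuedFraction.
Context {R : realType}.
Implicit Types (alpha x : R) (k : nat) (m : int).

Lemma irrational_invB x m : irrational x -> irrational (x^-1 - m%:~R).
Proof.
move=> x_irr [q _ qE]; apply: x_irr; exists (q + m%:~R)^-1 => //.
by rewrite fmorphV rmorphD /= ratr_int qE subrK invrK.
Qed.

Lemma irrational_neq0 x : irrational x -> x != 0.
Proof.
by move=> x_irr; apply/eqP => x0; apply: x_irr; exists 0; rewrite // raddf0.
Qed.

(* |theta_(k-1)|, with theta_(-1) = -1. *)
Definition gap alpha k : R := if k is k'.+1 then `|theta alpha k'| else 1.

Context {alpha : R}.
Hypotheses (alpha_irr : irrational alpha) (alpha01 : 0 < alpha < 1).

Lemma cf_tail_irrational k : irrational (cf_tail alpha k).
Proof. by elim: k => //= k IHk; apply: irrational_invB. Qed.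

Lemma cf_tail_neq0 k : cf_tail alpha k != 0.
Proof. exact: irrational_neq0 (cf_tail_irrational k). Qed.

Lemma cf_tail_itv k : 0 < cf_tail alpha k < 1.
Proof.
case: k => [//|k]; rewrite lt_def cf_tail_neq0 /= subr_ge0 floor_le /=.
by rewrite ltrBlDl -[X in _ + X]/(1%:~R) -intrD floorD1_gt.
Qed.

Lemma cf_digit_ge1 k : 1 <= cf_digit alpha k.+1.
Proof.
have /andP[x0 x1] := cf_tail_itv k.
by rewrite /cf_digit /= floor_ge_int invf_ge1 // ltW.
Qed.

Lemma thetaSS k : theta alpha k.+2 =
  (cf_digit alpha k.+2)%:~R * theta alpha k.+1 + theta alpha k.
Proof.
(* The recursions for p and q have the same coefficients, so theta inherits them by linearity; with
   arbitrary integers in place of p and q, the instance matches by conversion. *)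
have split m p p' q q' (x : R) : (m * q + q')%:~R * x - (m * p + p')%:~R =
    m%:~R * (q%:~R * x - p%:~R) + (q'%:~R * x - p'%:~R).
  by rewrite !intrD !intrM; ring.
exact: split.
Qed.

Lemma cf_qSS k :
  cf_q alpha k.+2 = cf_digit alpha k.+2 * cf_q alpha k.+1 + cf_q alpha k.
Proof. by []. Qed.

Lemma cf_q_ge0 k : 0 <= cf_q alpha k.
Proof.
suff: (0 <= cf_q alpha k) && (0 <= cf_q alpha k.+1) by case/andP.
elim: k => [|k /andP[q0 q1]].
  by have := cf_digit_ge1 0; rewrite /cf_q /=; lia.
rewrite q1 cf_qSS addr_ge0 ?mulr_ge0 //.
exact: le_trans (cf_digit_ge1 _).
Qed.

Lemma cf_tailSM k : cf_tail alpha k * cf_tail alpha k.+1 =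
  1 - (cf_digit alpha k.+1)%:~R * cf_tail alpha k.
Proof. by rewrite mulrBr mulfV ?cf_tail_neq0 // [in RHS]mulrC. Qed.

(** Consecutive thetas have a negative ratio; this yields both their alternating signs and the
    product form of [gap]. *)
Lemma thetaS k : theta alpha k.+1 = - (cf_tail alpha k.+1 * theta alpha k).
Proof.
elim: k => [|k IHk].
  have := cf_tailSM 0; rewrite /theta /cf_q /cf_p /=.
  rewrite !(mulr1, mulr0, addr0, add0r) mul1r subr0 [_ * alpha]mulrC => ->.
  by rewrite opprB mulrC.
apply: (mulfI (cf_tail_neq0 k.+1)).
rewrite thetaSS mulrN mulrA cf_tailSM mulrDr -[_ * theta alpha k]opprK -IHk.
by ring.
Qed.

Lemma theta_gap k : theta alpha k = (-1) ^+ k * gap alpha k.+1.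
Proof.
elim: k => [|k IHk]; first by rewrite mul1r /gap ger0_norm // /theta
  /cf_q /cf_p /= mul1r subr0; case/andP: alpha01 => /ltW.
rewrite thetaS IHk /gap thetaS normrN normrM gtr0_norm ?(andP (cf_tail_itv _)).1 //.
by rewrite exprS mulN1r mulNr mulrCA.
Qed.

Lemma gapS k : gap alpha k.+1 = cf_tail alpha k * gap alpha k.
Proof.
case: k => [|k].
  rewrite /gap /theta /cf_q /cf_p /= mul1r subr0 mulr1 gtr0_norm //.
  by case/andP: alpha01.
by rewrite /gap thetaS normrN normrM gtr0_norm //; case/andP: (cf_tail_itv k.+1).
Qed.

Lemma gapSS k :
  gap alpha k.+2 = gap alpha k - (cf_digit alpha k.+1)%:~R * gap alpha k.+1.
Proof.
by rewrite 2!gapS mulrA [cf_tail _ _.+1 * _]mulrC cf_tailSM mulrBl mul1r mulrA.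
Qed.

Lemma gap_gt0 k : 0 < gap alpha k.
Proof.
by elim: k => // k IHk; rewrite gapS mulr_gt0 //; case/andP: (cf_tail_itv k).
Qed.

Lemma gapS_lt k : gap alpha k.+1 < gap alpha k.
Proof.
by rewrite gapS gtr_pMl ?gap_gt0 //; case/andP: (cf_tail_itv k).
Qed.

Lemma gap_le1 k : gap alpha k <= 1.
Proof. by elim: k => // k; apply: le_trans; exact: ltW (gapS_lt k). Qed.

(** Since a_(k+1) >= 1, [gap k] is at least [gap k.+1 + gap k.+2], and [gap k.+1] exceeds
    [gap k.+2]. *)
Lemma gapSS_half k : 2 * gap alpha k.+2 < gap alpha k.
Proof.
have a1 : 1 <= (cf_digit alpha k.+1)%:~R :> R by rewrite ler1z cf_digit_ge1.
have := gapSS k; have := gapS_lt k.+1; have := gap_gt0 k.+1.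
nra.
Qed.

Lemma gap_cvg0 : gap alpha @ \oo --> (0 : R).
Proof.
(* Halving every two steps beats the decay of 2 / (k + 1), as (k + 3) / 2 <= k + 1 for k >= 1; k = 0
   is checked apart. The induction carries two consecutive bounds. *)
have gapM k : gap alpha k * k.+1%:R <= 2.
  suff: gap alpha k * k.+1%:R <= 2 /\ gap alpha k.+1 * k.+2%:R <= 2 by case.
  elim: k => [|k [IH1 IH2]]; first by have := gap_le1 1; rewrite /gap; split; lra.
  split=> //; have := gapSS_half k; have := gap_gt0 k.+2.
  case: k IH1 {IH2} => [|k]; first by rewrite /gap; lra.
  have -> : k.+4%:R = k%:R + 4 :> R by rewrite -addn4 natrD.
  have -> : k.+2%:R = k%:R + 2 :> R by rewrite -addn2 natrD.
  have := ler0n R k; nra.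
apply: (@squeeze_cvgr _ _ _ _ (cst 0) (fun k => 2 * harmonic k)).
- apply: nearW => k; rewrite ltW ?gap_gt0 //=.
  by rewrite -ler_pdivrMr ?invr_gt0 ?ltr0n // invrK.
- exact: cvg_cst.
- by rewrite -[X in _ --> X](mulr0 2); apply: cvgMl_tmp; exact: cvg_harmonic.
Qed.

End ContinuedFraction.

(** * The expansion algorithm: remainders, digits and partial sums *)

Section Expansion.
Context {R : realType}.
Context {alpha beta : R}.
Hypotheses (alpha_irr : irrational alpha) (alpha01 : 0 < alpha < 1)
  (beta01 : 0 <= beta < 1).
Implicit Types k n : nat.

Local Notation gap := (gap alpha).
Local Notation rem := (remainder alpha beta).
Let gap_gt0 := gap_gt0 alpha_irr alpha01.

(** Total version of b_k, so that l need not be tracked: once the remainder vanishes, all later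
    digits are 0. *)
Definition out_digit (a b : R) k : int :=
  Num.floor (remainder a b k.-1 / `|theta a k.-1|).
Local Notation digit := (out_digit alpha beta).

Lemma remainderS k : rem k.+1 = rem k - (digit k.+1)%:~R * gap k.+1.
Proof. by []. Qed.

Lemma remainderS_itv k : 0 <= rem k.+1 < gap k.+1.
Proof.
have g0 := gap_gt0 k.+1; rewrite remainderS subr_ge0 -ler_pdivlMr // floor_le.
rewrite ltrBlDl -[X in _ + X]mul1r -mulrDl -ltr_pdivrMr //.
by have := floorD1_gt (rem k / gap k.+1); rewrite intrD1.
Qed.

Lemma remainder_itv k : 0 <= rem k < gap k.
Proof. by case: k => [|k]; [exact: beta01 | exact: remainderS_itv]. Qed.

(** As [rem k < gap k], the quotient stays below [gap k / gap k.+1], the inverse of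
    [cf_tail alpha k], whose floor is a_(k+1). *)
Lemma out_digit_itv k : 0 <= digit k.+1 <= cf_digit alpha k.+1.
Proof.
have /andP[r0 r1] := remainder_itv k.
rewrite floor_ge0 divr_ge0 //= le_floor //.
have -> : (cf_tail alpha k)^-1 = gap k / gap k.+1.
  rewrite (gapS alpha_irr alpha01) invfM mulrCA divff ?mulr1 //.
  exact: lt0r_neq0.
by rewrite ler_pM2r ?invr_gt0 ?(gap_gt0 k.+1) // ltW.
Qed.

(** Removing a_(k+1) copies of [gap k.+1] from [rem k < gap k] leaves less than [gap k.+2], so the
    next quotient is below 1. *)
Lemma out_digit_full k :
  digit k.+1 = cf_digit alpha k.+1 -> digit k.+2 = 0.
Proof.
move=> dE; have /andP[r0 _] := remainder_itv k.+1.
have r1 : rem k.+1 < gap k.+2.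
  rewrite (gapSS alpha_irr alpha01) remainderS dE ltrD2r.
  by case/andP: (remainder_itv k).
apply/eqP; rewrite floor_eq add0r divr_ge0 //.
by rewrite ltr_pdivrMr ?(gap_gt0 k.+2) // mul1r.
Qed.

Lemma expansion_partial_sum n :
  \sum_(1 <= k < n.+1) (digit k)%:~R * `|theta alpha k.-1| = beta - rem n.
Proof.
elim: n => [|n IHn]; first by rewrite big_geq // subrr.
by rewrite big_nat_recr //= IHn opprB addrA addrAC.
Qed.

Lemma up_sum_remainder n :
  exists z : int, (up_sum alpha digit n)%:~R * alpha = beta - rem n + z%:~R.
Proof.
(* Termwise, (-1)^(k-1) q_(k-1) alpha = |theta_(k-1)| + (-1)^(k-1) p_(k-1). *)
exists (\sum_(1 <= k < n.+1) digit k * ((-1) ^+ k.-1 * cf_p alpha k.-1)).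
rewrite -expansion_partial_sum /up_sum !rmorph_sum /= mulr_suml -big_split /=.
apply: eq_big_nat => k _; rewrite /cf_qstar !rmorphM /= !rmorphXn /= rmorphN1.
have := theta_gap alpha_irr alpha01 k.-1; rewrite /gap /= => thE.
have -> : `|theta alpha k.-1| = (-1) ^+ k.-1 * theta alpha k.-1.
  by rewrite [in RHS]thE mulrA -expr2 sqrr_sign mul1r.
by rewrite /theta; ring.
Qed.

(* Even- and odd-indexed digits contribute to T_n with opposite signs, and
   a_k q_(k-1) = q_k - q_(k-2) telescopes in each class. *)
Lemma up_sum_itv n : - cf_q alpha n.+1 <=
  (-1) ^+ n.+1 * up_sum alpha digit n.+1 <= cf_q alpha n.
Proof.
elim: n => [|n /andP[IH1 IH2]].
  rewrite /up_sum big_nat1 /cf_qstar /cf_q /=.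
  by have := out_digit_itv 0; lia.
rewrite /up_sum big_nat_recr //= -/(up_sum alpha digit n.+1) /cf_qstar.
rewrite mulrDr exprS mulN1r !mulNr [_ * (_ * _)]mulrCA [_ * (_ * cf_q _ _)]mulrA.
rewrite -expr2 sqrr_sign mul1r cf_qSS.
have /andP[d0 d1] := out_digit_itv n.+1.
have q0 := cf_q_ge0 alpha_irr alpha01 n.+1.
have := ler_wpM2r q0 d1; have := mulr_ge0 d0 q0.
lia.
Qed.

(** For n >= 1 the signed sum lies between -q_n and q_(n-1), and q_(n-1) <= q_n because a_n >= 1. *)
Lemma up_sum_norm n : `|up_sum alpha digit n| <= cf_q alpha n.
Proof.
case: n => [|n]; first by rewrite /up_sum big_geq.
have -> : `|up_sum alpha digit n.+1| =
    `|(-1) ^+ n.+1 * up_sum alpha digit n.+1| by rewrite normrMsign.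
have := up_sum_itv n; have q0 := cf_q_ge0 alpha_irr alpha01.
case: n => [|n].
  by have := cf_digit_ge1 alpha_irr alpha01 0; rewrite ler_norml /cf_q /=; lia.
rewrite ler_norml cf_qSS => /andP[-> /le_trans->] //.
have := cf_digit_ge1 alpha_irr alpha01 n.+1; have := q0 n; have := q0 n.+1.
nia.
Qed.

Lemma gap_lt (e : R) : 0 < e -> exists N, forall n, (N <= n)%N -> gap n < e.
Proof.
move=> e0; have /cvgrPdist_lt/(_ e e0)[N _ NP] := gap_cvg0 alpha_irr alpha01.
exists N => n /NP; rewrite sub0r normrN; exact: le_lt_trans (ler_norm _).
Qed.

Lemma remainder_cvg0 : rem @ \oo --> (0 : R).
Proof.
apply: (@squeeze_cvgr _ _ _ _ (cst 0) gap); last exact: gap_cvg0.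
- by apply: nearW => k; have /andP[-> /ltW] := remainder_itv k.
- exact: cvg_cst.
Qed.

(** If all digits past n were 0, the remainder would stay at a positive constant, yet it is below
    [gap], which tends to 0. *)
Lemma out_digit_ge1_frequently n : (forall k, rem k <> 0) ->
  exists2 k, (n <= k)%N & 1 <= digit k.+1.
Proof.
move=> rem_neq0; apply: contrapT => no_digit.
have remE k : rem (n + k) = rem n.
  elim: k => [|k IHk]; first by rewrite addn0.
  rewrite addnS remainderS IHk; have /andP[d0 _] := out_digit_itv (n + k).
  suff -> : digit (n + k).+1 = 0 by rewrite mul0r subr0.
  have : ~ 1 <= digit (n + k).+1.
    by move=> ?; apply: no_digit; exists (n + k)%N; rewrite ?leq_addr.
  by move: d0; lia.
have rem_gt0 : 0 < rem n.
  by rewrite lt_def; apply/andP; split; [apply/eqP | case/andP: (remainder_itv n)].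
have [N NP] := gap_lt _ rem_gt0.
have /andP[_] := remainder_itv (n + N).
by rewrite remE ltNge ltW // NP // leq_addl.
Qed.

(* While the digits at k + 1, k + 3, ... are maximal, [gap - rem] stays
   constant and positive, although [gap] tends to 0. *)
Lemma out_digit_nonmax_frequently k :
  exists j, digit (k + j.*2).+1 <= cf_digit alpha (k + j.*2).+1 - 1.
Proof.
apply: contrapT => all_max.
have dE j : digit (k + j.*2).+1 = cf_digit alpha (k + j.*2).+1.
  have /andP[_] := out_digit_itv (k + j.*2).
  have : ~ digit (k + j.*2).+1 <= cf_digit alpha (k + j.*2).+1 - 1.
    by move=> ?; apply: all_max; exists j.
  by lia.
have gapE j : gap (k + j.*2) - rem (k + j.*2) = gap k - rem k.
  elim: j => [|j IHj]; first by rewrite addn0.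
  rewrite doubleS !addnS -IHj (gapSS alpha_irr alpha01) !remainderS.
  by rewrite (out_digit_full _ (dE j)) dE mul0r subr0; ring.
have gap_rem : 0 < gap k - rem k by rewrite subr_gt0; case/andP: (remainder_itv k).
have [N NP] := gap_lt _ gap_rem.
have /andP[r0 _] := remainder_itv (k + N.*2).
have : gap (k + N.*2) < gap k - rem k.
  by apply: NP; rewrite -addnn addnA leq_addl.
by rewrite -(gapE N) ltrBrDl gtrDr ltNge r0.
Qed.

End Expansion.

Lemma infinite_nat_unbounded (A : set nat) :
  (forall n, exists2 k, (n <= k)%N & A k) -> infinite_set A.
Proof.
move=> Aub /finite_seqP[s As].
have [k ks] := Aub (\max_(i <- s) i).+1; rewrite As /= => kIs.
by have := leq_bigmax_seq (F := id) k kIs isT; rewrite leqNgt ks.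
Qed.

(** * Distance to the nearest integer *)

Section Distance.
Context {R : realType}.
Implicit Types (r : R) (z : int).

Lemma dist_intDz r z : dist_int (r + z%:~R) = dist_int r.
Proof.
rewrite /dist_int /frac_part floorDrz ?intr_int // intrKfloor intrD.
by rewrite opprD addrACA subrr addr0.
Qed.

Lemma dist_int_itv r : 0 <= r < 1 -> dist_int r = Num.min r (1 - r).
Proof.
by move=> r01; rewrite /dist_int /frac_part (@floor_def _ _ 0) ?subr0.
Qed.

End Distance.

(** * Admissibility, convergence, the under property and the general solution *)

Theorem corollary3p4 (R : realType) (alpha beta : R)
    (alpha_irr : irrational alpha) (alpha01 : 0 < alpha < 1)
    (beta01 : 0 <= beta < 1)
    (l : option nat) (b : nat -> int)
    (b_out : expansion_output alpha beta l b) :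
  [/\ right_admissible alpha l b,
      expands_to alpha beta l b,
      (* an exact hit at n = l is over by definition, and so is T_1 = 0
         when 1/2 < beta < alpha *)
      forall n : nat, (1 <= n)%N -> lt_ext n l ->
        ~ (n = 1%N /\ 2^-1 < beta < alpha) ->
        under_approximate alpha beta (up_sum alpha b n) &
      general_solution alpha beta l (up_sum alpha b)].
Proof.
case: b_out => limit_l bE.
pose d := out_digit alpha beta.
pose rem := remainder alpha beta.
have ltW_ext n : lt_ext n l -> lt_ext n (succ_ext l).
  by case: (l) => //= L; apply: leqW.
have rem_neq0 n : lt_ext n l -> rem n <> 0.
  by move: limit_l; case: (l) => [L [_ LP]|LP] //= nL; exact: LP.
have bd k n : lt_ext n (succ_ext l) -> (1 <= k <= n)%N -> b k = d k.
  move=> nl /andP[k1 kn]; apply: bE => //.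
  by move: nl; case: (l) => //= L; exact: leq_ltn_trans.
have bd1 k : (1 <= k)%N -> lt_ext k (succ_ext l) -> b k = d k.
  by move=> k1 kl; apply: (bd k k); rewrite // k1 leqnn.
have up_sumE n : lt_ext n (succ_ext l) -> up_sum alpha b n = up_sum alpha d n.
  by move=> nl; apply: eq_big_nat => k kn; rewrite (bd k n).
have sumE n : lt_ext n (succ_ext l) ->
    \sum_(1 <= k < n.+1) (b k)%:~R * `|theta alpha k.-1| = beta - rem n.
  move=> nl; rewrite -(expansion_partial_sum (beta := beta)).
  by apply: eq_big_nat => k kn; rewrite (bd k n).
have rem_itv := remainder_itv alpha_irr alpha01 beta01.
have gap1 := gap_le1 alpha_irr alpha01.
have distE n : lt_ext n (succ_ext l) ->
    dist_int (beta - (up_sum alpha b n)%:~R * alpha) =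
    Num.min (rem n) (1 - rem n).
  move=> nl; have [z zE] := up_sum_remainder (beta := beta) alpha_irr alpha01 n.
  have -> : beta - (up_sum alpha b n)%:~R * alpha = rem n + (- z)%:~R.
    by rewrite up_sumE // zE mulrNz /rem; ring.
  rewrite dist_intDz.
  have /andP[r0 r1] := rem_itv n.
  by apply: dist_int_itv; rewrite r0 (lt_le_trans r1).
split.
- split.
  + split=> [[//|k] _ kl|].
      by rewrite bd1 //; exact: out_digit_itv.
    move: limit_l bd1 bE rem_neq0;
    case: (l) => [[//|L] [remL remLN]|limit_oo] bd1 _ rem_neq0.
      move=> _; rewrite bd1 //=; have := out_digit_itv alpha_irr alpha01 beta01 L.
      (* A last digit 0 would make the previous remainder vanish already, against the minimality of
         l. *)
      have : d L.+1 <> 0.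
        move=> d0; have := remainderS (alpha := alpha) (beta := beta) L.
        by rewrite remL -/d d0 mul0r subr0; apply/nesym/remLN.
      rewrite -/d; lia.
    (* Every tail contains a digit at least 1, so every tail supremum is at least 1. *)
    rewrite limn_esup_lim; apply: lime_ge; first exact: is_cvg_esups.
    apply: nearW => n.
    have [k nk dk] := out_digit_ge1_frequently alpha_irr alpha01 beta01 n limit_oo.
    apply: (@le_trans _ _ ((b k.+1)%:~R : R)%:E).
      by rewrite lee_fin ler1z bd1.
    apply: ereal_sup_ubound; exists k.+1; rewrite //= leqW //.
  + move=> [//|k] _ kl.
    have kl' : lt_ext k.+2 (succ_ext l).
      by move: kl; case: (l) => //= L; lia.
    have [-> ->] : b k.+1 = d k.+1 /\ b k.+2 = d k.+2.
      by split; apply: (bd _ k.+2) => //; lia.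
    exact: out_digit_full.
  + move=> l_oo; rewrite l_oo in bd1.
    have nonmax := out_digit_nonmax_frequently alpha_irr alpha01 beta01.
    (* Starting at 2n gives odd indices 2n + 2j + 1; starting at 2n + 1 gives even ones. *)
    split; apply: infinite_nat_unbounded => n.
      have [j jP] := nonmax n.*2.
      exists (n.*2 + j.*2).+1; first by lia.
      by split=> //; split; [lia | rewrite bd1].
    have [j jP] := nonmax n.*2.+1.
    exists (n.*2.+1 + j.*2).+1; first by lia.
    by split=> //; split; [lia | rewrite bd1].
- rewrite /expands_to; move: limit_l sumE.
  case: (l) => [L [remL _]|_] sumE.
    by rewrite sumE //= ?ltnS // /rem remL subr0.
  rewrite (_ : (fun n => _) = fun n => beta - rem n); last first.
    by apply/funext => n; rewrite sumE.
  rewrite -[X in _ --> X]subr0; apply: cvgB; first exact: cvg_cst.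
  exact: remainder_cvg0.
- move=> n n1 nl not_first [z].
  have [r0 r1] := andP (rem_itv n).
  have {}r0 : 0 < rem n by rewrite lt_def r0 andbT; apply/eqP/rem_neq0.
  (* For n >= 2, [rem n] is below [gap n], hence below half of [gap (n - 2)], which is at most 1.
     For n = 1 the bound fails only in the excluded case. *)
  have half : rem n <= 2^-1.
    case: n n1 nl not_first r1 r0 => [//|[|n]] _ nl not_first r1 r0; last first.
      have := gapSS_half alpha_irr alpha01 n; have := gap1 n.
      by move: r1; rewrite -/rem; lra.
    rewrite leNgt; apply/negP => half; apply: not_first; split=> //.
    have gap1E : gap alpha 1 = alpha by rewrite (gapS alpha_irr alpha01) mulr1.
    have remE : rem 1%N = beta - (d 1%N)%:~R * alpha.
      by rewrite -[in RHS]gap1E.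
    have /andP[d0 _] := out_digit_itv alpha_irr alpha01 beta01 0.
    have /andP[_ beta1] := beta01; move: r1; rewrite -/rem gap1E => r1.
    have [d_eq0|d_neq0] := eqVneq (d 1%N) 0.
      by move: remE; rewrite d_eq0 mul0r subr0 => <-; rewrite half r1.
    (* A positive first digit would give beta >= alpha + [rem 1] > 2 [rem 1] > 1. *)
    have d1 : 1 <= (d 1%N)%:~R :> R by rewrite ler1z -gtz0_ge1 lt_def d_neq0.
    have alpha_le : alpha <= (d 1%N)%:~R * alpha.
      by rewrite ler_peMl // ltW //; case/andP: alpha01.
    by exfalso; lra.
  have [w wE] := up_sum_remainder (beta := beta) alpha_irr alpha01 n.
  rewrite /iterate /frac_part up_sumE ?ltW_ext // wE.
  set f := Num.floor _.
  rewrite (_ : _ + z%:~R = beta - rem n + (w - f + z)%:~R); last first.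
    by rewrite mulrzDr mulrzBr /rem; ring.
  (* Being over [beta] would require an integer m with [rem n] <= m < [rem n] + 1/2 <= 1, impossible
     as [rem n] > 0. *)
  move: (w - f + z) => m /andP[m0 m1].
  have : 0 < m%:~R :> R by lra.
  have : m%:~R < 1 :> R by lra.
  by rewrite ltrz1 ltr0z; lia.
- split.
  + by move=> n _ nl; rewrite up_sumE //; exact: up_sum_norm.
  + move=> [//|n] _ nl; rewrite distE ?ltW_ext //.
    have /andP[r0 r1] := rem_itv n.+1.
    have {}r0 : 0 < rem n.+1 by rewrite lt_def r0 andbT; apply/eqP/rem_neq0.
    (* The upper bound comes from [rem] itself; 1 - [rem] is positive because every [gap] is at most
       1. *)
    rewrite lt_min gt_min r0 r1 subr_gt0 (lt_le_trans r1) //.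
  + move: limit_l distE; case: (l) => [L [remL _]|_] distE.
      by rewrite distE //= /rem remL subr0 min_l.
    rewrite (_ : (fun n => _) = fun n => Num.min (rem n) (1 - rem n)); last first.
      by apply/funext => n; rewrite distE.
    apply: (@squeeze_cvgr _ _ _ _ (cst 0) rem); last exact: remainder_cvg0.
      apply: nearW => n; have /andP[r0 r1] := rem_itv n.
      by rewrite le_min ge_min r0 lexx subr_ge0 (ltW (lt_le_trans r1 _)).
    exact: cvg_cst.
Qed.
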